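(* Let $1\le k\le j\le\infty$, let $\mathcal F\in\mathrm{Op}^{\mathrm{un}}_{\le k}$ be a unital $k$-restricted $\infty$-operad, and let $\mathrm{L}_k\colon\mathrm{Op}^{\mathrm{un}}_{\le k}\to\mathrm{Op}^{\mathrm{un}}_{\le j}$ be the functor given by left Kan extension along $i_k\colon\Omega^c_{\le k}\hookrightarrow\Omega^c_{\le j}$. Then for every integer $0\le n\le j$, the space $\mathrm{L}_k\mathcal F(\overline{C_n})$ is the colimit $$\operatorname*{colim}_{X\in((\Omega^c_{\le k})_{\overline{C_n}/^{\mathrm{rmax}}})^{\mathrm{op}}}\mathcal F(X).$$
   Context: **Trees.** A (dendroidal) tree $(T,L)$, often written $T$, is a finite poset $T$ with a minimal element (a least element, called the root) such that $\{y\le x\}$ is linearly ordered for every $x\in T$, together with a subset $L$ of the maximal elements of $T$ (the leaves). Elements of $T$ are called edges. For an edge $e$, $v(e)$ is the set of minimal elements of $T_{>e}$, and $|v(e)|$ is the valence of $e$. The edge $\eta$ is $(\{r\},\{r\})$; the $n$-corolla $C_n$ ($n\ge1$) is $\{0,1,\dots,n\}$ with $0$ least, $1,\dots,n$ pairwise incomparable and $L=\{1,\dots,n\}$; $C_0=(\{0\},\varnothing)$. **Category $\Omega$.** Objects are trees; $\mathrm{Hom}_\Omega(T,T')$ is the set of operad maps $\mathrm{Free}(T)\to\mathrm{Free}(T')$, where $\mathrm{Free}(T)$ is the coloured symmetric operad in sets with colours the edges of $T$, freely generated by one operation $v(e)\to e$ for each non-leaf edge $e$. **Closed trees.** A tree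 is closed if $L=\varnothing$; $\Omega^c\subset\Omega$ is the full subcategory of closed trees. (Explicitly: objects are finite rooted trees and morphisms are order-preserving maps that preserve independence, i.e. send incomparable pairs to incomparable pairs.) The inclusion $\Omega^c\hookrightarrow \Omega$ has left adjoint $(T,L)^c=(T,\varnothing)$; $\overline{C_n}:=C_n^c$. A tree is $k$-dendroidal if all its edges have valence $\le k$ (no condition if $k=\infty$); $\Omega^c_{\le k}\subset\Omega^c$ is the full subcategory of closed $k$-dendroidal trees, $\Omega^c_{\le\infty}=\Omega^c$. **Segal presheaves.** $\mathcal S$ is the $\infty$-category of spaces and $\mathcal P(\mathcal C)=\mathrm{Fun}(\mathcal C^{\mathrm{op}},\mathcal S)$. A morphism $f\colon T\to T'$ is a subtree inclusion if it is injective on edges and whenever $f(e_0)\le e'\le f(e_2)$ with $e'\in T'$, $e'$ lies in the image of $f$. For a tree $T$, $(\Omega^{\mathrm{el}})_{/T}\subset\Omega_{/T}$ is the full subcategory of subtree inclusions $f\colon X\to T$ with $X=\eta$ or $X=C_n$ for some $n$, where, if $X=C_n$ has root $x$, the edge $f(x)$ must also have valence $n$. A presheaf $\mathcal F$ on $\Omega^c_{\le k}$ is Segal if for every closed $k$-dendroidal $T$ the canonical map $\mathcal F(T)\to\lim_{X\in((\Omega^{\mathrm{el}})_{/T})^{\mathrm{op}}}\mathcal F(X^c)$ is an equivalence. Let $r\colon\Delta\to\Omega^c_{\le k}$ send $[n]$ to the closure of $(\{0\le1\le\dots\le n\},\{n\})$. A Segal presheaf $\mathcal F$ is complete if $r^*\mathcal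 F$ is a complete Segal space in the sense of Rezk. $\mathrm{Op}^{\mathrm{un}}_{\le k}$ is the full subcategory of $\mathcal P(\Omega^c_{\le k})$ on complete Segal presheaves; its objects are called unital $k$-restricted $\infty$-operads. Left Kan extension along $i_k$ sends $\mathrm{Op}^{\mathrm{un}}_{\le k}$ to $\mathrm{Op}^{\mathrm{un}}_{\le j}$. **Rooted max-surjective maps.** A morphism $f\colon T\to T'$ in $\Omega^c$ is rooted if it sends root to root, and max-surjective if for every $e'\in T'$ there is $e\in T$ with $f(e)\ge e'$. For a closed tree $T$, $(\Omega^c_{\le k})_{T/^{\mathrm{rmax}}}$ is the full subcategory of $(\Omega^c_{\le k})_{T/}=\Omega^c_{\le k}\times_{\Omega^c}(\Omega^c)_{T/}$ on the rooted max-surjective morphisms $T\to X$ with $X$ closed $k$-dendroidal. *)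

(* Defs.v *)
From Stdlib Require Import Relation_Operators.
From HB Require Import structures.
From mathcomp Require Import all_boot all_order.
From mathcomp Require Import boolp.

Set Implicit Arguments.
Unset Strict Implicit.
Unset Printing Implicit Defensive.
Set Primitive Projections.

Import Order.TTheory.

(** Spaces are modelled by simplicial sets up to weak homotopy equivalence, and
    the infinity-category Fun(C^op, S), for an ordinary category C, by strict
    functors from C^op to simplicial sets up to levelwise weak equivalence
    (every presheaf of spaces on an ordinary category has such a strict model,
    which can be taken with values in Kan complexes).  Limits and colimits of
    spaces are the Bousfield-Kan homotopy limits and colimits; left Kan
    extensions are given by the pointwise formula. *)

Record category := Category {
  ob :> Type;
  hom : ob -> ob -> Type;
  idm : forall x, hom x x;
  cmp : forall x y z, hom y z -> hom x y -> hom x z;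
  cmp1m : forall x y (f : hom x y), cmp (idm y) f = f;
  cmpm1 : forall x y (f : hom x y), cmp f (idm x) = f;
  cmpA : forall x y z w (h : hom z w) (g : hom y z) (f : hom x y),
    cmp h (cmp g f) = cmp (cmp h g) f }.

Arguments hom : clear implicits.
Arguments idm {c} x.
Arguments cmp {c x y z}.
Notation "g \c f" := (cmp g f) (at level 40, left associativity).

Definition op (C : category) : category :=
  @Category C (fun x y => hom C y x) (fun x => idm x)
    (fun x y z g f => f \c g)
    (fun x y f => cmpm1 f) (fun x y f => cmp1m f)
    (fun x y z w h g f => esym (cmpA f g h)).

Record functor (C D : category) := Functor {
  fob :> C -> D;
  fmap : forall x y, hom C x y -> hom D (fob x) (fob y);
  fmap1 : forall x, fmap (idm x) = idm (fob x);
  fmapM : forall x y z (g : hom C y z) (f : hom C x y),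
    fmap (g \c f) = fmap g \c fmap f }.

Arguments fmap {C D} f {x y} : rename.

Definition fcomp (C D E : category) (G : functor D E) (F : functor C D) :
  functor C E.
Proof.
exists (fun x => G (F x)) (fun x y f => fmap G (fmap F f)).
- by move=> x; rewrite !fmap1.
- by move=> x y z g f; rewrite !fmapM.
Defined.

Definition fop (C D : category) (F : functor C D) : functor (op C) (op D) :=
  @Functor (op C) (op D) F (fun x y f => fmap F f) (fun x => fmap1 F x)
    (fun x y z g f => fmapM F f g).

Record fullsub_ob (C : category) (P : C -> Prop) := FullsubOb {
  fsval :> C;
  fsprop : P fsval }.

Definition fullsub (C : category) (P : C -> Prop) : category :=
  @Category (fullsub_ob P) (fun x y => hom C x y) (fun x => idm (fsval x))
    (fun x y z g f => g \c f)
    (fun x y f => cmp1m f) (fun x y f => cmpm1 f)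
    (fun x y z w h g f => cmpA h g f).

Definition fullsub_incl (C : category) (P : C -> Prop) :
  functor (fullsub P) C :=
  @Functor (fullsub P) C (@fsval C P) (fun x y f => f)
    (fun x => erefl) (fun x y z g f => erefl).

Definition fullsub_mono (C : category) (P Q : C -> Prop)
    (PQ : forall x, P x -> Q x) : functor (fullsub P) (fullsub Q) :=
  @Functor (fullsub P) (fullsub Q)
    (fun x => FullsubOb (PQ x (fsprop x))) (fun x y f => f)
    (fun x => erefl) (fun x y z g f => erefl).

Record over_ob (C : category) (b : C) := OverOb {
  osrc : C;
  oarr : hom C osrc b }.

Record over_hom (C : category) (b : C) (x y : over_ob b) := OverHom {
  oval :> hom C (osrc x) (osrc y);
  ovalP : oarr y \c oval = oarr x }.

Lemma over_hom_inj (C : category) (b : C) (x y : over_ob b) (f g : over_hom x y) :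
  oval f = oval g -> f = g.
Proof.
case: f g => [f fP] [g gP] /= fg; case: _ / fg gP => gP.
by congr OverHom; exact: Prop_irrelevance.
Qed.

Definition over (C : category) (b : C) : category.
Proof.
exists (over_ob b) (@over_hom C b)
  (fun x => OverHom (cmpm1 (oarr x)))
  (fun x y z g f => @OverHom C b x z (oval g \c oval f)
     (etrans (cmpA _ _ _) (etrans (congr1 (fun u => u \c oval f) (ovalP g))
       (ovalP f)))).
- by move=> x y f; apply: over_hom_inj; exact: cmp1m.
- by move=> x y f; apply: over_hom_inj; exact: cmpm1.
- by move=> x y z w h g f; apply: over_hom_inj; exact: cmpA.
Defined.

Definition over_push (C : category) (b b' : C) (u : hom C b b') :
  functor (over b) (over b').
Proof.
exists (fun x => OverOb (u \c oarr x))
  (fun x y (f : over_hom x y) => @OverHom C b' (OverOb (u \c oarr x)) (OverOb (u \c oarr y))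
    (oval f) (etrans (esym (cmpA _ _ _)) (congr1 (fun v => u \c v) (ovalP f)))).
- by move=> x; exact: over_hom_inj.
- by move=> x y z g f; exact: over_hom_inj.
Defined.

(** The comma category of pairs [(x, b -> F x)]; for [F] the inclusion of a
    subcategory this is the fibre product of that subcategory with the slice
    under [b]. *)

Record under_ob (A B : category) (F : functor A B) (b : B) := UnderOb {
  utgt : A;
  uarr : hom B b (F utgt) }.

Record under_hom (A B : category) (F : functor A B) (b : B)
    (x y : under_ob F b) := UnderHom {
  uval :> hom A (utgt x) (utgt y);
  uvalP : fmap F uval \c uarr x = uarr y }.

Lemma under_hom_inj (A B : category) (F : functor A B) (b : B)
    (x y : under_ob F b) (f g : under_hom x y) :
  uval f = uval g -> f = g.
Proof.
case: f g => [f fP] [g gP] /= fg; case: _ / fg gP => gP.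
by congr UnderHom; exact: Prop_irrelevance.
Qed.

Definition under_id (A B : category) (F : functor A B) (b : B)
    (x : under_ob F b) : under_hom x x.
Proof. by exists (idm (utgt x)); rewrite fmap1 cmp1m. Defined.

Definition under_cmp (A B : category) (F : functor A B) (b : B)
    (x y z : under_ob F b) (g : under_hom y z) (f : under_hom x y) :
  under_hom x z.
Proof. by exists (uval g \c uval f); rewrite fmapM -cmpA !uvalP. Defined.

Definition under (A B : category) (F : functor A B) (b : B) : category.
Proof.
exists (under_ob F b) (@under_hom A B F b) (@under_id A B F b)
  (@under_cmp A B F b).
- by move=> x y f; apply: under_hom_inj; exact: cmp1m.
- by move=> x y f; apply: under_hom_inj; exact: cmpm1.
- by move=> x y z w h g f; apply: under_hom_inj; exact: cmpA.
Defined.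

Definition under_proj (A B : category) (F : functor A B) (b : B) :
  functor (under F b) A :=
  @Functor (under F b) A (@utgt A B F b) (fun x y f => uval f)
    (fun x => erefl) (fun x y z g f => erefl).

Definition under_pre (A B : category) (F : functor A B) (b b' : B)
    (u : hom B b b') : functor (under F b') (under F b).
Proof.
exists (fun x : under F b' => UnderOb (uarr x \c u) : under F b)
  (fun x y (f : under_hom x y) => @UnderHom A B F b (UnderOb (uarr x \c u))
     (UnderOb (uarr y \c u)) (uval f)
     (etrans (cmpA _ _ _) (congr1 (fun v => v \c u) (uvalP f)))).
- by move=> x; exact: under_hom_inj.
- by move=> x y z g f; exact: under_hom_inj.
Defined.

Record mono (m n : nat) := Mono {
  monof :> 'I_m.+1 -> 'I_n.+1;
  monofP : forall i j : 'I_m.+1, i <= j -> monof i <= monof j }.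

Lemma mono_inj m n (f g : mono m n) : monof f =1 monof g -> f = g.
Proof.
case: f g => [f fP] [g gP] /= /funext fg; case: _ / fg gP => gP.
by congr Mono; exact: Prop_irrelevance.
Qed.

Definition mono_id n : mono n n := @Mono n n id (fun i j ij => ij).

Definition mono_cmp m n p (g : mono n p) (f : mono m n) : mono m p :=
  @Mono m p (g \o f) (fun i j ij => monofP g (monofP f ij)).

Definition Delta : category.
Proof.
by exists nat mono mono_id mono_cmp => *; exact: mono_inj.
Defined.

Definition mono_const m n (i : 'I_n.+1) : mono m n :=
  @Mono m n (fun=> i) (fun _ _ _ => leqnn _).

Definition face n (i : 'I_n.+2) : mono n n.+1.
Proof.
exists (lift i) => j k jk.
by rewrite /= leq_bump2.
Defined.

Definition spine_edge n (i : 'I_n) : mono 1 n.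
Proof.
exists (fun a => if a == ord0 then widen_ord (leqnSn n) i else lift ord0 i).
move=> a b; case: (a =P ord0) => [_|a0]; case: (b =P ord0) => [->|b0] //= ab.
by case: a0; apply: val_inj; apply/eqP; rewrite -leqn0.
Defined.

Record sset := SSet {
  sx :> nat -> Type;
  sact : forall m n, mono m n -> sx n -> sx m;
  sact1 : forall n (x : sx n), sact (mono_id n) x = x;
  sactM : forall m n p (g : mono n p) (f : mono m n) (x : sx p),
    sact (mono_cmp g f) x = sact f (sact g x) }.

Arguments sact s {m n} : rename.

Record smap (X Y : sset) := SMap {
  sfun :> forall n, X n -> Y n;
  sfunP : forall m n (f : mono m n) (x : X n),
    sfun (sact X f x) = sact Y f (sfun x) }.

Arguments sfun {X Y} s {n} : rename.

Definition smap_id X : smap X X := @SMap X X (fun n x => x) (fun _ _ _ _ => erefl).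

Definition smap_cmp X Y Z (g : smap Y Z) (f : smap X Y) : smap X Z :=
  @SMap X Z (fun n x => g n (f n x))
    (fun m n t x => etrans (congr1 _ (sfunP f t x)) (sfunP g t (f n x))).

Definition simplex (n : nat) : sset.
Proof.
by exists (fun m => mono m n) (fun m p f x => mono_cmp x f) => *; exact: mono_inj.
Defined.

Definition sprod (X Y : sset) : sset.
Proof.
exists (fun n => (X n * Y n)%type)
  (fun m n f x => (sact X f x.1, sact Y f x.2)).
- by move=> n [x y]; rewrite /= !sact1.
- by move=> m n p g f [x y]; rewrite /= !sactM.
Defined.

Record subsset_at (X : sset) (P : forall n, X n -> Prop) (n : nat) := SubAt {
  subval : X n;
  subvalP : P n subval }.

Lemma subsset_inj (X : sset) (P : forall n, X n -> Prop) n (a b : subsset_at P n) :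
  subval a = subval b -> a = b.
Proof.
case: a b => [a aP] [b bP] /= ab; case: _ / ab bP => bP.
by congr SubAt; exact: Prop_irrelevance.
Qed.

Definition subsset (X : sset) (P : forall n, X n -> Prop)
  (PP : forall m n (f : mono m n) (x : X n), P n x -> P m (sact X f x)) : sset.
Proof.
exists (subsset_at P) (fun m n f a => SubAt (PP _ _ f _ (subvalP a))).
- by move=> n a; apply: subsset_inj; exact: sact1.
- by move=> m n p g f a; apply: subsset_inj; exact: sactM.
Defined.

Definition subsset_incl (X : sset) P PP : smap (@subsset X P PP) X :=
  @SMap (subsset PP) X (fun n a => subval a) (fun _ _ _ _ => erefl).

(** The horn: simplices of Delta^n whose image together with [k] is not
    everything. *)

Definition in_horn n (k : 'I_n.+1) m (x : simplex n m) : Prop :=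
  exists2 i, i != k & forall j, x j != i.

Lemma in_hornP n (k : 'I_n.+1) m p (f : mono m p) (x : simplex n p) :
  in_horn k x -> in_horn k (sact (simplex n) f x).
Proof. by case=> i ik xi; exists i => // j; exact: xi. Qed.

Definition horn n (k : 'I_n.+1) : sset := subsset (@in_hornP n k).

Definition horn_incl n (k : 'I_n.+1) : smap (horn k) (simplex n) :=
  subsset_incl (@in_hornP n k).

Definition kan_complex (K : sset) : Prop :=
  forall n (k : 'I_n.+2) (u : smap (horn k) K),
    exists w : smap (simplex n.+1) K, smap_cmp w (horn_incl k) = u.

Definition kan_fibration (X Y : sset) (p : smap X Y) : Prop :=
  forall n (k : 'I_n.+2) (u : smap (horn k) X) (v : smap (simplex n.+1) Y),
    smap_cmp p u = smap_cmp v (horn_incl k) ->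
    exists w : smap (simplex n.+1) X,
      smap_cmp w (horn_incl k) = u /\ smap_cmp p w = v.

Definition elementary_homotopy (X K : sset) (u v : smap X K) : Prop :=
  exists H : smap (sprod X (simplex 1)) K,
    (forall n x, H n (x, mono_const n ord0) = u n x) /\
    (forall n x, H n (x, mono_const n ord_max) = v n x).

Definition homotopic (X K : sset) : smap X K -> smap X K -> Prop :=
  clos_refl_sym_trans _ (@elementary_homotopy X K).

(** A map is a weak homotopy equivalence when it induces a bijection on
    homotopy classes of maps into every Kan complex. *)

Definition weak_equivalence (X Y : sset) (f : smap X Y) : Prop :=
  forall K : sset, kan_complex K ->
    (forall u : smap X K, exists v : smap Y K, homotopic (smap_cmp v f) u) /\
    (forall v v' : smap Y K,
       homotopic (smap_cmp v f) (smap_cmp v' f) -> homotopic v v').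

Definition connected (X : sset) : X 0 -> X 0 -> Prop :=
  clos_refl_sym_trans _ (fun a b => exists e : X 1,
    sact X (mono_const 0 ord0) e = a /\ sact X (mono_const 0 ord_max) e = b).

Record diagram (C : category) := Diagram {
  dob :> C -> sset;
  dmap : forall x y, hom C x y -> smap (dob x) (dob y);
  dmap1 : forall x n (a : dob x n), dmap (idm x) n a = a;
  dmapM : forall x y z (g : hom C y z) (f : hom C x y) n (a : dob x n),
    dmap (g \c f) n a = dmap g n (dmap f n a) }.

Arguments dmap {C} d {x y} : rename.

Definition presheaf (C : category) := diagram (op C).

Definition pres (C : category) (F : presheaf C) (x y : C) (f : hom C x y) :
  smap (F y) (F x) := @dmap (op C) F y x f.

Definition dpull (C D : category) (u : functor C D) (X : diagram D) : diagram C.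
Proof.
exists (fun x => X (u x)) (fun x y f => dmap X (fmap u f)).
- by move=> x n a; rewrite fmap1 dmap1.
- by move=> x y z g f n a; rewrite fmapM dmapM.
Defined.

Definition ordcat (n : nat) : category.
Proof.
exists 'I_n.+1 (fun i j => is_true (i <= j)%N) (fun i => leqnn i)
  (fun i j k jk ij => leq_trans ij jk) => *; exact: bool_irrelevance.
Defined.

Definition ordcat_map m n (f : mono m n) : functor (ordcat m) (ordcat n).
Proof.
by exists (monof f) (fun i j ij => monofP f ij) => *; exact: bool_irrelevance.
Defined.

Lemma functor_congr (C D : category) (o : C -> D)
    (a : forall x y, hom C x y -> hom D (o x) (o y)) p1 p1' pM pM' :
  @Functor C D o a p1 pM = @Functor C D o a p1' pM'.
Proof. by congr Functor; exact: Prop_irrelevance. Qed.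

Definition nerve (C : category) : sset.
Proof.
exists (fun n => functor (ordcat n) C) (fun m n f c => fcomp c (ordcat_map f)).
- by move=> n c; exact: functor_congr.
- by move=> m n p g f c; exact: functor_congr.
Defined.

(** The homotopy colimit of [D : I -> sset] is the diagonal of its simplicial
    replacement: an [n]-simplex is a chain [i_0 -> ... -> i_n] in [I] together
    with an [n]-simplex of [D i_0]. *)

Record hocolim_at (I : category) (D : diagram I) (n : nat) := HocolimAt {
  hchain : nerve I n;
  hpoint : D (hchain ord0) n }.

Lemma hocolim_congr (I : category) (D : diagram I) n (o : ordcat n -> I)
    (a : forall x y, hom (ordcat n) x y -> hom I (o x) (o y)) p1 p1' pM pM'
    (x x' : D (o ord0) n) : x = x' ->
  @HocolimAt I D n (@Functor _ _ o a p1 pM) x =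
  @HocolimAt I D n (@Functor _ _ o a p1' pM') x'.
Proof.
move=> ->; rewrite (Prop_irrelevance p1 p1').
by rewrite (Prop_irrelevance pM pM').
Qed.

Definition hocolim_act (I : category) (D : diagram I) m n (f : mono m n)
    (s : hocolim_at D n) : hocolim_at D m :=
  @HocolimAt I D m (sact (nerve I) f (hchain s))
    (dmap D (@fmap _ _ (hchain s) ord0 (f ord0) (leq0n (f ord0))) m
       (sact _ f (hpoint s))).

Definition hocolim (I : category) (D : diagram I) : sset.
Proof.
exists (hocolim_at D) (@hocolim_act I D).
- move=> n s; apply: hocolim_congr.
  rewrite sact1 -[RHS]dmap1 -fmap1.
  apply: (congr1 (fun h => dmap D (@fmap _ _ (hchain s) ord0 ord0 h) n (hpoint s))).
  exact: bool_irrelevance.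
- move=> m n p g f s; apply: hocolim_congr => /=.
  rewrite sactM -sfunP -dmapM -fmapM.
  apply: (congr1 (fun h => dmap D (@fmap _ _ (hchain s) ord0 (g (f ord0)) h) m
    (sact _ f (sact _ g (hpoint s))))).
  exact: bool_irrelevance.
Defined.

(** The map of homotopy colimits induced by a functor [u : I -> J] and a natural
    transformation from [D] to the restriction of [E] along [u]. *)

Definition hocolim_map (I J : category) (u : functor I J)
    (D : diagram I) (E : diagram J) (t : forall i, smap (D i) (E (u i)))
    (tP : forall i j (f : hom I i j) n (a : D i n),
       t j n (dmap D f n a) = dmap E (fmap u f) n (t i n a)) :
  smap (hocolim D) (hocolim E).
Proof.
exists (fun n (s : hocolim D n) =>
  @HocolimAt J E n (fcomp u (hchain s)) (t _ n (hpoint s))).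
move=> m n f s; apply: hocolim_congr => /=.
by rewrite tP sfunP.
Defined.

(** The homotopy limit of [D : I -> sset] is the simplicial set of natural
    transformations from [i |-> nerve (over i)] to [D]: an [n]-simplex is a
    natural family of maps [nerve (over i) x Delta^n -> D i]. *)

Record holim_at (I : category) (D : diagram I) (n : nat) := HolimAt {
  hfam : forall i m, nerve (over i) m -> simplex n m -> D i m;
  hfam_simp : forall i m p (f : mono m p) (c : nerve (over i) p) (t : simplex n p),
    hfam (sact (nerve (over i)) f c) (sact (simplex n) f t) =
    sact (D i) f (hfam c t);
  hfam_nat : forall i j (u : hom I i j) m (c : nerve (over i) m) (t : simplex n m),
    @hfam j m (fcomp (over_push u) c) t = dmap D u m (@hfam i m c t) }.

Lemma holim_congr (I : category) (D : diagram I) n (s s' : holim_at D n) :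
  (forall i m c t, @hfam I D n s i m c t = @hfam I D n s' i m c t) -> s = s'.
Proof.
case: s s' => [h hs hn] [h' hs' hn'] /= E.
have {}E : h = h'.
  by apply: functional_extensionality_dep => i;
     apply: functional_extensionality_dep => m;
     apply/funext => c; apply/funext => t.
case: _ / E hs' hn' => hs' hn'.
by congr HolimAt; exact: Prop_irrelevance.
Qed.

Definition holim_act (I : category) (D : diagram I) m n (f : mono m n)
    (s : holim_at D n) : holim_at D m.
Proof.
exists (fun i p c t => @hfam I D n s i p c (mono_cmp f t)).
- move=> i p q g c t; rewrite -hfam_simp.
  by congr (hfam _ _); exact: mono_inj.
- by move=> i j u p c t; rewrite hfam_nat.
Defined.

Definition holim (I : category) (D : diagram I) : sset.
Proof.
exists (holim_at D) (@holim_act I D).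
- by move=> n s; apply: holim_congr => i m c t; congr (hfam _ _); exact: mono_inj.
- by move=> m n p g f s; apply: holim_congr => i q c t; congr (hfam _ _);
     exact: mono_inj.
Defined.

Definition holim_map (I : category) (D : diagram I) (Y : sset)
    (t : forall i, smap Y (D i))
    (tP : forall i j (f : hom I i j) n (y : Y n), dmap D f n (t i n y) = t j n y) :
  smap Y (holim D).
Proof.
unshelve eexists (fun n y => @HolimAt I D n
  (fun i m c f => t i m (sact Y f y)) _ _).
- by move=> i m p f c g; rewrite -sfunP; congr (sfun _ _); rewrite -sactM.
- by move=> i j u m c f; rewrite tP.
- move=> m n f y; apply: holim_congr => i p c g /=.
  by rewrite -sactM.
Defined.

(** Pointwise left Kan extension of a presheaf along [u : A -> B]

    Its value at [b] is the homotopy colimit of [F x] over the opposite of the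
    category of pairs [(x, b -> u x)]. *)

Definition lan_diagram (A B : category) (u : functor A B) (F : presheaf A) (b : B) :
  diagram (op (under u b)) := dpull (fop (under_proj u b)) F.

Definition lan_map (A B : category) (u : functor A B) (F : presheaf A) (b b' : B)
    (g : hom B b b') :
  smap (hocolim (lan_diagram u F b')) (hocolim (lan_diagram u F b)) :=
  @hocolim_map _ _ (fop (under_pre u g)) (lan_diagram u F b') (lan_diagram u F b)
    (fun x => smap_id (F (utgt x))) (fun i j f n a => erefl).

(* Two simplices of the left Kan extension agree when they have the same
   underlying chain in [A], the same point, and the same maps out of [b]. *)
Lemma lan_congr (A B : category) (u : functor A B) (F : presheaf A) (b : B) n
    (X : 'I_n.+1 -> A) (l l' : forall i, hom B b (u (X i)))
    (a : forall i j : 'I_n.+1, (i <= j)%N -> hom A (X j) (X i))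
    (aP : forall (i j : 'I_n.+1) (ij : (i <= j)%N), fmap u (a i j ij) \c l j = l i)
    (aP' : forall (i j : 'I_n.+1) (ij : (i <= j)%N), fmap u (a i j ij) \c l' j = l' i)
    p1 p1' pM pM' (x : F (X ord0) n) :
  (forall i, l i = l' i) ->
  @HocolimAt (op (under u b)) (lan_diagram u F b) n
    (@Functor (ordcat n) (op (under u b)) (fun i => UnderOb (l i))
       (fun i j ij => @UnderHom A B u b (UnderOb (l j)) (UnderOb (l i))
          (a i j ij) (aP i j ij)) p1 pM) x =
  @HocolimAt (op (under u b)) (lan_diagram u F b) n
    (@Functor (ordcat n) (op (under u b)) (fun i => UnderOb (l' i))
       (fun i j ij => @UnderHom A B u b (UnderOb (l' j)) (UnderOb (l' i))
          (a i j ij) (aP' i j ij)) p1' pM') x.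
Proof.
move=> ll'; have {}ll' : l = l' by exact: functional_extensionality_dep.
case: _ / ll' aP' p1' pM' => aP'; rewrite (Prop_irrelevance aP' aP) => p1' pM'.
exact: hocolim_congr.
Qed.

Definition Lan (A B : category) (u : functor A B) (F : presheaf A) : presheaf B.
Proof.
apply: (@Diagram (op B) (fun b => hocolim (lan_diagram u F b))
  (fun b b' g => @lan_map A B u F b' b g)).
- move=> b n s.
  refine (@lan_congr A B u F b n (fun i => utgt (hchain s i))
    (fun i => uarr (hchain s i) \c idm b) (fun i => uarr (hchain s i))
    (fun i j ij => uval (@fmap _ _ (hchain s) i j ij)) _ _ _ _ _ _ (hpoint s) _).
  by move=> i; exact: cmpm1.
- move=> b b' b'' g f n s.
  refine (@lan_congr A B u F b'' n (fun i => utgt (hchain s i))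
    (fun i => uarr (hchain s i) \c ((f : hom B b' b) \c (g : hom B b'' b')))
    (fun i => uarr (hchain s i) \c (f : hom B b' b) \c (g : hom B b'' b'))
    (fun i j ij => uval (@fmap _ _ (hchain s) i j ij)) _ _ _ _ _ _ (hpoint s) _).
  by move=> i; exact: cmpA.
Defined.

Record tree := Tree {
  tdisp : Order.disp_t;
  edge :> finPOrderType tdisp;
  leaf : {set edge};
  tree_root : exists r : edge, forall x, (r <= x)%O;
  tree_linear : forall x y z : edge, (y <= x)%O -> (z <= x)%O -> (y >=< z)%O;
  leaf_max : forall x y : edge, x \in leaf -> (x <= y)%O -> y = x }.

Definition is_root (T : tree) (r : T) : Prop := forall x : T, (r <= x)%O.

Definition above (T : tree) (e : T) : {set T} :=
  [set x : T | (e < x)%O && [forall y : T, (e < y)%O ==> (y <= x)%O ==> (y == x)]].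

Definition valence (T : tree) (e : T) : nat := #|above e|.

Definition closed_tree (T : tree) : Prop := leaf T = set0.

Definition tree_closure (T : tree) : tree.
Proof.
exists (tdisp T) (edge T) set0.
- exact: tree_root.
- exact: tree_linear.
- by move=> x y; rewrite inE.
Defined.

Definition linear (n : nat) : tree.
Proof.
exists _ 'I_n.+1 [set ord_max].
- by exists ord0 => x; rewrite leEord.
- by move=> x y z _ _; exact: comparableT.
- move=> x y /set1P -> ny; apply: val_inj; apply/eqP.
  by rewrite eqn_leq -ltnS ltn_ord.
Defined.

Definition eta : tree := linear 0.

(** The edges {0, ..., n} of the corolla, with 0 below everything and 1, ..., n
    pairwise incomparable. *)
Definition corolla_edge (n : nat) := 'I_n.+1.

Section CorollaOrder.
Variable n : nat.
HB.instance Definition _ := Finite.on (corolla_edge n).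

Definition corolla_le (x y : corolla_edge n) := (x == ord0) || (x == y).

Lemma corolla_le_refl : reflexive corolla_le.
Proof. by move=> x; rewrite /corolla_le eqxx orbT. Qed.

Lemma corolla_le_anti : antisymmetric corolla_le.
Proof.
by move=> x y; rewrite /corolla_le => /andP[/orP[/eqP->|/eqP//] /orP[/eqP|/eqP]].
Qed.

Lemma corolla_le_trans : transitive corolla_le.
Proof.
move=> y x z; rewrite /corolla_le => /orP[->//|/eqP->].
by case/orP=> [->//|/eqP->]; rewrite eqxx orbT.
Qed.

HB.instance Definition _ := Order.Le_isPOrder.Build (Order.Disp tt tt)
  (corolla_edge n) corolla_le_refl corolla_le_anti corolla_le_trans.
End CorollaOrder.

Lemma le_corolla n (x y : corolla_edge n) :
  (x <= y)%O = (x == ord0) || (x == y).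
Proof. by []. Qed.

Definition corolla (n : nat) : tree.
Proof.
exists _ (corolla_edge n) [set x | x != ord0].
- by exists ord0 => x; rewrite le_corolla eqxx.
- move=> x y z; rewrite /Order.comparable !le_corolla.
  case: (y =P ord0) => //= _ /eqP ->; case: (z =P ord0) => //= [_ _|_ /eqP ->].
    by rewrite orbT.
  by rewrite eqxx.
- by move=> x y; rewrite inE le_corolla => /negbTE -> /= /eqP.
Defined.

(** The operad Free(T).  Every edge is the output of at most one generator and
    the inputs of an operation are pairwise distinct, so for each signature
    (inputs [l], output [e]) there is at most one operation; Free(T) is thus
    recorded by the set of signatures of its operations, closed under
    identities, generators, partial composition and permutation of inputs. *)
Inductive free_op (T : tree) : seq T -> T -> Prop :=
| free_id e : free_op [:: e] e
| free_gen e : e \notin leaf T -> free_op (enum (above e)) e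
| free_comp l1 l l2 x e :
    free_op (l1 ++ x :: l2) e -> free_op l x -> free_op (l1 ++ l ++ l2) e
| free_perm l l' e : perm_eq l l' -> free_op l e -> free_op l' e.

(** As the operads Free(T) have at most one operation per signature, an operad
    map is a map on colours that preserves the existence of operations. *)
Record tree_hom (S T : tree) := TreeHom {
  hom_edge :> S -> T;
  hom_op : forall l e, @free_op S l e -> @free_op T (map hom_edge l) (hom_edge e) }.

Lemma tree_hom_inj (S T : tree) (f g : tree_hom S T) :
  hom_edge f =1 hom_edge g -> f = g.
Proof.
case: f g => [f fP] [g gP] /= /funext fg; case: _ / fg gP => gP.
by congr TreeHom; exact: Prop_irrelevance.
Qed.

Definition tree_id (T : tree) : tree_hom T T.
Proof. by exists id => l e; rewrite map_id. Defined.

Definition tree_cmp (R S T : tree) (g : tree_hom S T) (f : tree_hom R S) :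
  tree_hom R T.
Proof.
by exists (g \o f) => l e le; rewrite map_comp; do 2!apply: hom_op.
Defined.

Definition Omega : category.
Proof. by exists tree tree_hom tree_id tree_cmp => *; exact: tree_hom_inj. Defined.

(* An operad map out of Free(S) is determined by its values on generators. *)
Definition hom_of_gen (S T : tree) (f : S -> T)
  (fP : forall e, e \notin leaf S -> @free_op T (map f (enum (above e))) (f e)) :
  tree_hom S T.
Proof.
exists f => l e; elim=> {l e} [e|e /fP //|l1 l l2 x e _ IH1 _ IH2|l l' e ll' _ IH].
- exact: free_id.
- by move: IH1; rewrite !map_cat /= => IH1; exact: free_comp IH1 IH2.
- by apply: free_perm IH; exact: perm_map.
Defined.

Lemma free_op_cap (T : tree) (l1 l : seq T) (e : T) :
  (forall x, x \in l -> @free_op T [::] x) -> free_op (l1 ++ l) e -> free_op l1 e.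
Proof.
elim: l => [|x l IH] capl; first by rewrite cats0.
move=> /free_comp /(_ (capl x _)); rewrite inE eqxx => /(_ isT) /= xl.
by apply: IH xl => y yl; apply: capl; rewrite inE yl orbT.
Qed.

Lemma above_lt (T : tree) (e x : T) : x \in above e -> (e < x)%O.
Proof. by rewrite inE => /andP[]. Qed.

Lemma above_ltW (T : tree) (e y : T) : (e < y)%O ->
  exists2 x, x \in above e & (x <= y)%O.
Proof.
elim/ltn_ind: {y}#|[set z : T | z <= y]%O| {-2}y (erefl #|[set z : T | z <= y]%O|).
move=> n IH y yn ey.
have [yv|] := boolP (y \in above e); first by exists y.
rewrite inE ey /= negb_forall => /existsP[z].
rewrite !negb_imply => /and3P[ez zy nzy].
have [||x xe xz] := IH _ _ z erefl; last by exists x => //; exact: le_trans zy.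
- rewrite -yn; apply: proper_card; apply/properP; split.
    by apply/subsetP => t; rewrite !inE => tz; exact: le_trans zy.
  by exists y; rewrite !inE //; apply: contra nzy => yz; rewrite eq_le zy yz.
- by [].
Qed.

Lemma above_ind (T : tree) (P : T -> Prop) :
  (forall e, (forall x : T, (e < x)%O -> P x) -> P e) -> forall e, P e.
Proof.
move=> IH e.
elim/ltn_ind: {e}#|[set z : T | e < z]%O| {-2}e (erefl #|[set z : T | e < z]%O|).
move=> n IHn e en; apply: IH => x ex; apply: IHn (erefl _).
rewrite -en; apply: proper_card; apply/properP; split.
  by apply/subsetP => t; rewrite !inE; exact: lt_trans.
by exists x; rewrite !inE ?ltxx.
Qed.

Lemma closed_op_nil (T : tree) : closed_tree T -> forall e : T, @free_op T [::] e.
Proof.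
move=> cT; apply: above_ind => e IH.
apply: (@free_op_cap T [::] (enum (above e))).
  by move=> x; rewrite mem_enum => /above_lt; exact: IH.
by apply: free_gen; rewrite cT inE.
Qed.

Lemma closed_op_le (T : tree) : closed_tree T ->
  forall x y : T, (x <= y)%O -> @free_op T [:: y] x.
Proof.
move=> cT; apply: above_ind => x IH y.
rewrite le_eqVlt => /predU1P[->|xy]; first exact: free_id.
have [z zx zy] := above_ltW xy.
have := @free_gen T x; rewrite cT inE => /(_ isT) gx.
have zin : z \in enum (above x) by rewrite mem_enum.
have zx1 := @free_op_cap T [:: z] _ x (fun t _ => closed_op_nil cT t)
  (free_perm (perm_to_rem zin) gx).
exact: (@free_comp T [::] [:: y] [::] z x zx1 (IH z (above_lt zx) y zy)).
Qed.

Lemma free_op_inputs (T : tree) (l : seq T) (e : T) : free_op l e ->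
  [/\ uniq l, (forall x, x \in l -> (e <= x)%O) &
      {in l &, forall x y, (x <= y)%O -> x = y}].
Proof.
elim=> {l e} [e|e _|l1 l l2 x e _ [u1 le1 a1] _ [u2 le2 a2]|l l' e ll' _ [u1 le1 a1]].
- split=> // [x|x y]; rewrite !inE; first by move=> /eqP->.
  by move=> /eqP-> /eqP->.
- split; [exact: enum_uniq|by move=> x; rewrite mem_enum => /above_lt /ltW|].
  move=> x y; rewrite !mem_enum => /above_lt ex; rewrite inE => /andP[ey /forallP/(_ x)].
  by rewrite ex /= => /implyP xy /xy/eqP.
- have xin : x \in l1 ++ x :: l2 by rewrite mem_cat inE eqxx orbT.
  have sub t : t \in l1 ++ l2 -> t \in l1 ++ x :: l2.
    by rewrite !mem_cat inE => /orP[->|->]; rewrite ?orbT.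
  have [u12 xn] : uniq (l1 ++ l2) /\ x \notin l1 ++ l2.
    by move: u1; rewrite -cat1s uniq_catCA /= => /andP[].
  have sep y z : y \in l -> z \in l1 ++ l2 -> ~~ (y >=< z)%O.
    move=> yl zl; apply/negP => yz.
    suff : x = z by move=> E; rewrite E zl in xn.
    have xy := le2 _ yl.
    case/orP: yz => [yz|zy].
      exact: (a1 x z xin (sub z zl) (le_trans xy yz)).
    have /orP[xz|zx] := tree_linear xy zy.
      exact: (a1 x z xin (sub z zl) xz).
    exact: esym (a1 z x (sub z zl) xin zx).
  have mm t : t \in l1 ++ l ++ l2 -> t \in l \/ t \in l1 ++ l2.
    by rewrite !mem_cat => /or3P[->|->|->]; rewrite ?orbT; [right|left|right].
  split.
  + rewrite uniq_catCA cat_uniq u2 u12 andbT /=.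
    apply/hasP => -[z zl /= yl]; move/negP: (sep _ _ yl zl); apply.
    by rewrite /Order.comparable lexx.
  + by move=> t /mm[/le2|/sub/le1//]; apply: le_trans; exact: le1.
  + move=> y z /mm[yl|yl] /mm[zl|zl] yz; first exact: a2.
    - by case/negP: (sep _ _ yl zl); rewrite /Order.comparable yz.
    - by case/negP: (sep _ _ zl yl); rewrite /Order.comparable yz orbT.
    - exact: (a1 y z (sub y yl) (sub z zl) yz).
- split; first by rewrite -(perm_uniq ll').
    by move=> x; rewrite -(perm_mem ll'); exact: le1.
  by move=> x y; rewrite -!(perm_mem ll'); exact: a1.
Qed.


Lemma perm_filter_flatten (T : eqType) (l s : seq T) (P : T -> pred T) :
  {in s &, forall x x' y, P x y -> P x' y -> x = x'} -> uniq s ->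
  perm_eq (flatten [seq filter (P x) l | x <- s])
          (filter (fun y => has (P^~ y) s) l).
Proof.
elim: s => [|x s IH] Ps /=; first by rewrite (eq_filter (a2 := pred0)) ?filter_pred0.
case/andP=> xs us.
have {}IH : perm_eq (flatten [seq filter (P x) l | x <- s])
    (filter (fun y => has (P^~ y) s) l).
  by apply: IH => // b c bs cs; apply: Ps; rewrite inE ?bs ?cs orbT.
apply/permP => a; rewrite count_cat (permP IH a) !count_filter -count_predUI.
rewrite (@eq_count _ (predI _ _) pred0) ?count_pred0 ?addn0; last first.
  move=> y /=; apply/negP => /andP[/andP[_ xy] /andP[_ /hasP[z zs zy]]].
  by rewrite (Ps x z _ _ y xy zy) ?inE ?eqxx ?zs ?orbT // zs in xs.
by apply: eq_count => y /=; rewrite -andb_orr.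
Qed.

Lemma free_op_flatten (T : tree) (L : T -> seq T) (e : T) s l1 :
  free_op (l1 ++ s) e -> (forall x, x \in s -> free_op (L x) x) ->
  free_op (l1 ++ flatten (map L s)) e.
Proof.
elim: s l1 => [//|x s IH] l1 H LP /=.
rewrite catA; apply: IH => [|y ys]; last by apply: LP; rewrite inE ys orbT.
by rewrite -catA; apply: free_comp H _; apply: LP; rewrite mem_head.
Qed.

Lemma closed_free_op (T : tree) : closed_tree T -> forall (e : T) (l : seq T),
  uniq l -> (forall x, x \in l -> (e <= x)%O) ->
  {in l &, forall x y, (x <= y)%O -> x = y} -> free_op l e.
Proof.
move=> cT; apply: above_ind => e IH l ul lel al.
have [el|el] := boolP (e \in l).
  apply: (@free_perm T [:: e] l); last exact: free_id.
  apply: uniq_perm => // t; rewrite inE; apply/eqP/idP => [->//|tl].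
  exact: esym (al _ _ el tl (lel _ tl)).
have ltl x : x \in l -> (e < x)%O.
  by move=> xl; rewrite lt_neqAle lel // andbT; apply: contraNneq el => ->.
have ge := @free_gen T e; rewrite cT inE in ge; have {}ge := ge isT.
have := @free_op_flatten T (fun x => filter (fun y => (x <= y)%O) l) e _ [::] ge.
rewrite /= => H.
have {}H : free_op (flatten [seq [seq y <- l | (x <= y)%O] | x <- enum (above e)]) e.
  apply: H => z0; rewrite mem_enum => /above_lt ez0; apply: IH => //.
  - exact: filter_uniq.
  - by move=> y; rewrite mem_filter => /andP[].
  - by move=> y z; rewrite !mem_filter => /andP[_ yl] /andP[_ zl]; exact: al.
apply: (free_perm _ H); apply: (perm_trans (perm_filter_flatten _ _ _)).
- move=> x x'; rewrite !mem_enum => xe x'e y xy x'y.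
  have /orP[xx|xx] := tree_linear xy x'y.
    move: x'e (above_lt xe); rewrite inE => /andP[_ /forallP/(_ x)] + ex.
    by rewrite ex xx /= => /eqP.
  move: xe (above_lt x'e); rewrite inE => /andP[_ /forallP/(_ x')] + ex.
  by rewrite ex xx /= => /eqP.
- exact: enum_uniq.
- suff -> : filter (fun y => has (fun x : T => (x <= y)%O) (enum (above e))) l = l by [].
  apply/all_filterP/allP => y yl; have [x xe xy] := above_ltW (ltl _ yl).
  by apply/hasP; exists x; rewrite ?mem_enum.
Qed.

(** Between closed trees, operad maps are the order-preserving maps that send
    incomparable pairs to incomparable pairs. *)
Lemma tree_hom_closedP (S T : tree) (f : S -> T) : closed_tree S -> closed_tree T ->
  (exists g : tree_hom S T, hom_edge g = f) <->
  (forall x y : S, (x <= y)%O -> (f x <= f y)%O) /\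
  (forall x y : S, ~~ (x >=< y)%O -> ~~ (f x >=< f y)%O).
Proof.
move=> cS cT; split=> [[g <-]|[fm fi]].
  split=> x y xy.
    have [_ + _] := free_op_inputs (hom_op g (closed_op_le cS xy)).
    by apply; rewrite mem_head.
  have [r rP] := tree_root S.
  have op2 : free_op [:: x; y] r.
    apply: closed_free_op => //=.
    + rewrite inE andbT; apply: contra xy => /eqP->; exact: comparablexx.
    + move=> a b; rewrite !inE => /orP[]/eqP-> /orP[]/eqP-> //; move=> ab; 
      by case/negP: xy; rewrite /Order.comparable ab ?orbT.
  have [/= u _ a] := free_op_inputs (hom_op g op2).
  move: u; rewrite inE andbT => /eqP u; apply/negP => /orP[] h.
    by apply: u; apply: a h; rewrite !inE eqxx ?orbT.
  by apply: u; apply/esym; apply: a h; rewrite !inE eqxx ?orbT.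
have fP e : e \notin leaf S -> free_op (map f (enum (above e))) (f e).
  move=> eS; have [u leS a] := free_op_inputs (free_gen eS).
  have fa : {in enum (above e) &, forall x y, (f x <= f y)%O -> x = y}.
    move=> x y xe ye fxy; have [/orP[xy|yx]|nxy] := boolP (x >=< y)%O.
    - exact: a.
    - by apply/esym/a.
    - by have := fi _ _ nxy; rewrite /Order.comparable fxy.
  apply: closed_free_op => //.
  - rewrite map_inj_in_uniq // => x y xe ye E; apply: fa => //.
    by rewrite E lexx.
  - by move=> _ /mapP[x xe ->]; apply: fm; exact: leS.
  - by move=> _ _ /mapP[x xe ->] /mapP[y ye ->] /(fa _ _ xe ye)->.
by exists (hom_of_gen fP).
Qed.

(** The adjunct, under closure, of a map to a closed tree. *)
Definition closure_adj (S T : tree) (cT : closed_tree T) (f : tree_hom S T) :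
  tree_hom (tree_closure S) T.
Proof.
apply: (@hom_of_gen (tree_closure S) T f) => e _.
have [eS|eS] := boolP (e \in leaf S); last exact: (hom_op f (free_gen eS)).
suff -> : enum (@above (tree_closure S) e) = [::] by exact: closed_op_nil.
apply/eqP; rewrite -size_eq0 -cardE cards_eq0; apply/set0Pn => -[x].
move=> /above_lt ex.
by have := leaf_max eS (ltW ex) => xe; move: ex; rewrite xe ltxx.
Defined.

Lemma tree_closureP (T : tree) : closed_tree (tree_closure T).
Proof. by []. Qed.

(** The functor (T, L) |-> (T, empty) on morphisms. *)
Definition closure_hom (S T : tree) (f : tree_hom S T) :
  tree_hom (tree_closure S) (tree_closure T).
Proof.
apply: (@closure_adj S (tree_closure T) (tree_closureP T)).
apply: (@tree_cmp S T) f.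
apply: (@hom_of_gen T (tree_closure T) id) => e _; rewrite map_id.
by apply: (@free_gen (tree_closure T)); rewrite inE.
Defined.

(** In bounds on valences, [None] stands for infinity; [Omegac None] is the
    category of all closed trees. *)

Definition leq_ext (k j : option nat) : bool :=
  match k, j with
  | _, None => true
  | None, Some _ => false
  | Some k, Some j => (k <= j)%N
  end.

Definition dendroidal (k : option nat) (T : tree) : Prop :=
  forall e : T, leq_ext (Some (valence e)) k.

Lemma leq_ext_trans j k l : leq_ext k j -> leq_ext j l -> leq_ext k l.
Proof. by case: k j l => [k|] [j|] [l|] //=; exact: leq_trans. Qed.

Definition closed_dendroidal (k : option nat) (T : Omega) : Prop :=
  closed_tree T /\ dendroidal k T.

Definition Omegac (k : option nat) : category := fullsub (closed_dendroidal k).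

Definition incl (k j : option nat) (kj : leq_ext k j) :
  functor (Omegac k) (Omegac j) :=
  @fullsub_mono Omega (closed_dendroidal k) (closed_dendroidal j)
    (fun T (P : closed_dendroidal k T) => conj P.1 (fun e => leq_ext_trans (P.2 e) kj)).

Lemma valence_corolla n (e : corolla n) :
  valence e <= n /\ (e != ord0 -> valence e = 0).
Proof.
have lt0 (x : corolla n) : (e < x)%O -> (e == ord0) && (x != ord0).
  rewrite lt_neqAle le_corolla => /andP[ex /orP[/eqP e0|/eqP e0]].
    by rewrite -e0 eqxx eq_sym.
  by rewrite e0 eqxx in ex.
split.
  suff : above e \subset [set~ ord0].
    by move=> /subset_leq_card; rewrite cardsC1 card_ord.
  by apply/subsetP => x /above_lt /lt0 /andP[_]; rewrite !inE.
move=> e0; apply/eqP; rewrite cards_eq0; apply/set0Pn => -[x].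
by move=> /above_lt /lt0; rewrite (negbTE e0).
Qed.

Definition closed_corolla (n : nat) (j : option nat) (nj : leq_ext (Some n) j) :
  Omegac j :=
  @FullsubOb Omega (closed_dendroidal j) (tree_closure (corolla n))
    (conj erefl (fun e => @leq_ext_trans (Some n) (Some _) j
                            (valence_corolla e).1 nj)).

Definition subtree_inclusion (S T : tree) (f : tree_hom S T) : Prop :=
  injective f /\
  (forall (e0 e2 : S) (e' : T), (f e0 <= e')%O -> (e' <= f e2)%O ->
     exists e1, f e1 = e').

Definition elementary (T : tree) (x : over (T : Omega)) : Prop :=
  subtree_inclusion (oarr x) /\
  (osrc x = eta \/
   exists n, osrc x = corolla n /\
     forall r : osrc x, is_root r -> valence (oarr x r) = n).

Definition Omega_el (T : tree) : category := fullsub (@elementary T).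

Lemma valence_linear n (e : linear n) : valence e <= 1.
Proof.
apply/card_le1_eqP => x y; rewrite !inE => /andP[ex /forallP xm] /andP[ey /forallP ym].
have /orP[xy|yx] := le_total (x : 'I_n.+1) y.
  by move: (ym x); rewrite ex /= => /implyP /(_ xy) /eqP.
by move: (xm y); rewrite ey /= => /implyP /(_ yx) /eqP.
Qed.

Lemma corolla_root0 n : is_root (ord0 : corolla n).
Proof. by move=> x; rewrite le_corolla eqxx. Qed.

Lemma elementary_dendroidal (k : option nat) (T : Omegac k) (x : Omega_el (fsval T)) :
  closed_dendroidal k (tree_closure (osrc (fsval x))).
Proof.
split=> //; case: x => -[S f] [_ /= [SE|[n [SE val_r]]]]; subst S => e.
  have -> : @valence (tree_closure eta) e = 0; last by case: (k).
  apply/eqP; rewrite cards_eq0; apply/set0Pn => -[x].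
  by move=> /above_lt; rewrite (ord1 x) (ord1 e) ltxx.
have [_ /(_ (f (ord0 : corolla n)))] := fsprop T.
rewrite (val_r _ (@corolla_root0 n)); apply: leq_ext_trans.
exact: (valence_corolla (e : corolla n)).1.
Qed.

(** [(f : X -> T) |-> X^c] *)
Definition el_closure (k : option nat) (T : Omegac k) :
  functor (Omega_el (fsval T)) (Omegac k).
Proof.
unshelve refine (@Functor (Omega_el (fsval T)) (Omegac k)
  (fun x => @FullsubOb Omega (closed_dendroidal k)
              (tree_closure (osrc (fsval x))) (elementary_dendroidal x))
  (fun x y f => closure_hom (oval f)) _ _) => *; exact: tree_hom_inj.
Defined.

Definition el_arr (k : option nat) (T : Omegac k) (x : Omega_el (fsval T)) :
  hom (Omegac k) (el_closure T x) T :=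
  closure_adj (fsprop T).1 (oarr (fsval x)).

Definition el_diagram (k : option nat) (F : presheaf (Omegac k)) (T : Omegac k) :
  diagram (op (Omega_el (fsval T))) := dpull (fop (el_closure T)) F.

Lemma el_cone (k : option nat) (F : presheaf (Omegac k)) (T : Omegac k)
    (x y : op (Omega_el (fsval T))) (f : hom (op (Omega_el (fsval T))) x y) n (a : F T n) :
  dmap (el_diagram F T) f n (pres F (el_arr x) n a) =
  pres F (el_arr y) n a.
Proof.
transitivity (pres F (el_arr x \c @fmap _ _ (el_closure T) y x f) n a).
  exact: (esym (@dmapM (op (Omegac k)) F _ _ _ _ _ n a)).
congr (sfun (pres F _) a); apply: tree_hom_inj => e /=.
by rewrite -[in RHS](ovalP f).
Qed.

Definition segal_map (k : option nat) (F : presheaf (Omegac k)) (T : Omegac k) :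
  smap (F T) (holim (el_diagram F T)) :=
  @holim_map _ (el_diagram F T) (F T)
    (fun x => pres F (el_arr x))
    (@el_cone k F T).

Definition segal (k : option nat) (F : presheaf (Omegac k)) : Prop :=
  forall T : Omegac k, weak_equivalence (segal_map F T).

Definition simplicial_space := presheaf Delta.

Section Rezk.
Variable X : simplicial_space.

Definition pb m n (f : mono m n) : smap (X n) (X m) :=
  @pres Delta X m n f.

Lemma pbM q p n (f : mono p n) (g : mono q p) m (x : X n m) :
  pb (mono_cmp f g) m x = pb g m (pb f m x).
Proof. exact: (@dmapM (op Delta) X n p q g f m x). Qed.

Lemma pb1 n m (x : X n m) : pb (mono_id n) m x = x.
Proof. exact: (@dmap1 (op Delta) X n m x). Qed.

(** The matching object: an [m]-simplex is a compatible family indexed by the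
    simplices of the boundary of Delta^n. *)
Record matching_at (n m : nat) := MatchingAt {
  mfam : forall p (f : mono p n), (exists i, forall j, f j != i) -> X p m;
  mfamP : forall p q (f : mono p n) (g : mono q p) hf hfg,
    @mfam q (mono_cmp f g) hfg = pb g m (@mfam p f hf) }.

Lemma matching_inj n m (a b : matching_at n m) :
  (forall p f h, @mfam n m a p f h = @mfam n m b p f h) -> a = b.
Proof.
case: a b => [a aP] [b bP] /= ab.
have {}ab : a = b.
  by do 3!apply: functional_extensionality_dep => ?; exact: ab.
case: _ / ab bP => bP; congr MatchingAt; exact: Prop_irrelevance.
Qed.

Definition matching (n : nat) : sset.
Proof.
unshelve eexists (matching_at n)
  (fun m' m t b => @MatchingAt n m'
     (fun p f h => sact (X p) t (@mfam n m b p f h)) _).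
- move=> p q f g hf hfg /=; rewrite sfunP; congr (sact _ _ _); exact: mfamP.
- by move=> m b; apply: matching_inj => p f h; exact: sact1.
- by move=> m m' m'' g f b; apply: matching_inj => p t h; exact: sactM.
Defined.

Definition matching_map (n : nat) : smap (X n) (matching n).
Proof.
unshelve eexists (fun m x => @MatchingAt n m (fun p f _ => pb f m x) _).
- by move=> p q f g hf hfg; exact: pbM.
- by move=> m' m t x; apply: matching_inj => p f h; exact: sfunP.
Defined.

Definition reedy_fibrant : Prop := forall n, kan_fibration (matching_map n).

(** X_1 x_{X_0} ... x_{X_0} X_1 *)
Definition spine_matched n m (a : 'I_n -> X 1 m) : Prop :=
  forall i i' : 'I_n, i' = i.+1 :> nat ->
    pb (mono_const 0 ord_max) m (a i) = pb (mono_const 0 ord0) m (a i').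

Record spine_at n m := SpineAt {
  spval : 'I_n -> X 1 m;
  spvalP : spine_matched spval }.

Lemma spine_inj n m (a b : spine_at n m) : spval a =1 spval b -> a = b.
Proof.
case: a b => [a aP] [b bP] /= /funext ab; case: _ / ab bP => bP.
by congr SpineAt; exact: Prop_irrelevance.
Qed.

Definition spine (n : nat) : sset.
Proof.
unshelve eexists (spine_at n)
  (fun m' m t a => @SpineAt n m' (fun i => sact (X 1) t (spval a i)) _).
- by move=> i i' ii'; rewrite !sfunP (spvalP a ii').
- by move=> m a; apply: spine_inj => i; exact: sact1.
- by move=> m m' m'' g f a; apply: spine_inj => i; exact: sactM.
Defined.

Definition spine_map (n : nat) : smap (X n) (spine n).
Proof.
unshelve eexists (fun m x => @SpineAt n m (fun i => pb (spine_edge i) m x) _).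
- move=> i i' ii'; rewrite -!pbM; congr (sfun (pb _) x).
  by apply: mono_inj => j; apply: val_inj; rewrite /= ii'.
- by move=> m' m t x; apply: spine_inj => i; exact: sfunP.
Defined.

Definition segal_space : Prop :=
  reedy_fibrant /\ forall n, (2 <= n)%N -> weak_equivalence (spine_map n).

(** map(x, y) is the fibre of [X 1 -> X 0 x X 0] over [(x, y)]. *)

Definition in_map (x y : X 0 0) m (a : X 1 m) : Prop :=
  pb (mono_const 0 ord0) m a = sact (X 0) (mono_const m ord0) x /\
  pb (mono_const 0 ord_max) m a = sact (X 0) (mono_const m ord0) y.

Lemma in_mapP (x y : X 0 0) m n (f : mono m n) (a : X 1 n) :
  in_map x y a -> in_map x y (sact (X 1) f a).
Proof.
by case=> ax ay; split; rewrite sfunP ?ax ?ay -sactM;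
  congr (sact _ _ _); exact: mono_inj.
Qed.

Definition map_space (x y : X 0 0) : sset := subsset (@in_mapP x y).

Definition id_edge (x : X 0 0) : X 1 0 := pb (mono_const 1 ord0) 0 x.

Lemma pb_to0 n (f : mono n 0) (x : X 0 0) : pb f 0 x = pb (mono_const n ord0) 0 x.
Proof. by congr (sfun (pb _) x); apply: mono_inj => i; rewrite !(ord1 (_ i)). Qed.

Lemma id_edgeP (x : X 0 0) : in_map x x (id_edge x).
Proof.
suff E n (f : mono 0 n) : pb f 0 (pb (mono_const n ord0) 0 x) =
    sact (X 0) (mono_const 0 ord0) x by split; exact: E.
rewrite -pbM pb_to0.
rewrite (_ : mono_const 0 ord0 = mono_id 0) ?pb1 ?sact1 //.
by apply: mono_inj => i; rewrite (ord1 i).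
Qed.

Definition id_map (x : X 0 0) : map_space x x 0 := SubAt (id_edgeP x).

(** [gf] is a composition of [f] and [g]: some [k] in [X 2] has faces
    [d_2 k = f], [d_0 k = g] and [d_1 k = gf]. *)
Definition is_composite (x y z : X 0 0) (g : map_space y z 0)
    (f : map_space x y 0) (gf : map_space x z 0) : Prop :=
  exists k : X 2 0,
    [/\ pb (face ord_max) 0 k = subval f,
        pb (face ord0) 0 k = subval g &
        pb (face (lift ord0 ord0)) 0 k = subval gf].

Definition homotopy_equivalence (x y : X 0 0) (g : map_space x y 0) : Prop :=
  (exists (f : map_space y x 0) (gf : map_space y y 0),
     is_composite g f gf /\ connected gf (id_map y)) /\
  (exists (h : map_space y x 0) (hg : map_space x x 0),
     is_composite h g hg /\ connected hg (id_map x)).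

(** X_hoequiv: the components of [X 1] consisting of homotopy equivalences. *)

Definition is_hoequiv (a : X 1 0) : Prop :=
  exists (x y : X 0 0) (g : map_space x y 0),
    subval g = a /\ homotopy_equivalence g.

Definition in_hoequiv m (a : X 1 m) : Prop :=
  forall i : 'I_m.+1, is_hoequiv (sact (X 1) (mono_const 0 i) a).

Lemma in_hoequivP m n (f : mono m n) (a : X 1 n) :
  in_hoequiv a -> in_hoequiv (sact (X 1) f a).
Proof.
move=> ha i; rewrite -sactM (_ : mono_cmp _ _ = mono_const 0 (f i)) //.
exact: mono_inj.
Qed.

Definition hoequiv : sset := subsset in_hoequivP.

Lemma id_hoequiv (x : X 0 0) : is_hoequiv (id_edge x).
Proof.
have idc : is_composite (id_map x) (id_map x) (id_map x).
  exists (pb (mono_const 2 ord0) 0 x); rewrite /= /id_edge.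
  by split; rewrite -pbM pb_to0.
by exists x, x, (id_map x); split=> //; split;
  exists (id_map x), (id_map x); split=> //; exact: rst_refl.
Qed.

Lemma degen_hoequiv m (x : X 0 m) : in_hoequiv (pb (mono_const 1 ord0) m x).
Proof. by move=> i; rewrite -sfunP; exact: id_hoequiv. Qed.

Definition degen_map : smap (X 0) hoequiv.
Proof.
exists (fun m x => @SubAt (X 1) in_hoequiv m _ (degen_hoequiv x)).
by move=> m n f x; apply: subsset_inj; exact: sfunP.
Defined.

Definition complete_segal_space : Prop :=
  segal_space /\ weak_equivalence degen_map.

End Rezk.

Lemma one_le_valence (k : option nat) (k1 : leq_ext (Some 1) k) (n : nat) :
  closed_dendroidal k (tree_closure (linear n)).
Proof.
split=> // e; apply: leq_ext_trans k1.
exact: (valence_linear (e : linear n)).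
Qed.

Definition linear_hom m n (f : mono m n) :
  tree_hom (tree_closure (linear m)) (tree_closure (linear n)).
Proof.
apply: (@hom_of_gen (tree_closure (linear m)) (tree_closure (linear n)) f) => e _.
have : size (enum (@above (tree_closure (linear m)) e)) <= 1.
  by rewrite -cardE; exact: (valence_linear (e : linear m)).
have : forall x, x \in enum (@above (tree_closure (linear m)) e) -> (e < x)%O.
  by move=> x; rewrite mem_enum; exact: above_lt.
case: (enum _) => [|x [|//]] ex _ /=; first exact: closed_op_nil.
apply: closed_op_le => //; have /ltW := ex x (mem_head _ _).
by rewrite !leEord; exact: monofP.
Defined.

Definition rDelta (k : option nat) (k1 : leq_ext (Some 1) k) :
  functor Delta (Omegac k).
Proof.
unshelve refine (@Functor Delta (Omegac k)
  (fun n => @FullsubOb Omega (closed_dendroidal k)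
              (tree_closure (linear n)) (one_le_valence k1 n))
  (fun m n f => linear_hom f) _ _) => *; exact: tree_hom_inj.
Defined.

Definition levelwise_equivalence (C : category) (X Y : diagram C)
    (t : forall x, smap (X x) (Y x)) : Prop :=
  (forall x y (f : hom C x y) n (a : X x n),
     t y n (dmap X f n a) = dmap Y f n (t x n a)) /\
  forall x, weak_equivalence (t x).

(** Rezk's complete Segal spaces are Reedy fibrant; a simplicial space is
    complete Segal as a simplicial object in the infinity-category of spaces
    when some levelwise weakly equivalent Reedy fibrant one is complete Segal. *)
Definition complete (k : option nat) (k1 : leq_ext (Some 1) k)
    (F : presheaf (Omegac k)) : Prop :=
  exists (Y : simplicial_space)
    (t : forall n : op Delta, smap (dpull (fop (rDelta k1)) F n) (Y n)),
    levelwise_equivalence t /\ complete_segal_space Y.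

Record unital_operad (k : option nat) (k1 : leq_ext (Some 1) k) := UnitalOperad {
  underlying :> presheaf (Omegac k);
  underlying_kan : forall T : Omegac k, kan_complex (underlying T);
  underlying_segal : segal underlying;
  underlying_complete : complete k1 underlying }.

Definition rooted (S T : tree) (f : tree_hom S T) : Prop :=
  forall r : S, is_root r -> is_root (f r).

Definition max_surjective (S T : tree) (f : tree_hom S T) : Prop :=
  forall e' : T, exists e : S, (e' <= f e)%O.

(** Homs out of [T] are the same in [Omegac j] and in all closed trees, so this
    does not depend on [j]. *)
Definition under_rmax (k j : option nat) (kj : leq_ext k j) (T : Omegac j) :
  category :=
  fullsub (fun x : under (incl kj) T => rooted (uarr x) /\ max_surjective (uarr x)).

Definition rmax_diagram (k j : option nat) (kj : leq_ext k j)
    (F : presheaf (Omegac k)) (T : Omegac j) : diagram (op (under_rmax kj T)) :=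
  dpull (fop (fcomp (under_proj (incl kj) T) (fullsub_incl _))) F.

Definition Lk (k j : option nat) (kj : leq_ext k j) (F : presheaf (Omegac k)) :
  presheaf (Omegac j) := Lan (incl kj) F.

(** The canonical map from the colimit over rooted max-surjective maps. *)
Definition rmax_map (k j : option nat) (kj : leq_ext k j)
    (F : presheaf (Omegac k)) (T : Omegac j) :
  smap (hocolim (rmax_diagram kj F T)) (Lk kj F T) :=
  @hocolim_map _ _ (fop (fullsub_incl _)) (rmax_diagram kj F T)
    (lan_diagram (incl kj) F T)
    (fun x => smap_id (F (utgt (fsval x)))) (fun x y f n a => erefl).

(* Main.v *)
(** The rooted max-surjective maps out of [T] form a coreflective subcategory of
    all maps out of [T]: the coreflection of [f : T -> X] is the convex hull of
    the image of [f] in [X], which is again closed and has no larger valences.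
    On opposite categories its counit is a natural transformation from the
    identity, which induces homotopies exhibiting the map of homotopy colimits as
    a homotopy equivalence. *)
Require Import Defs.
From Stdlib Require Import Relation_Operators.
From HB Require Import structures.
From mathcomp Require Import all_boot all_order.
From mathcomp Require Import boolp.

Set Implicit Arguments.
Unset Strict Implicit.
Unset Printing Implicit Defensive.

Import Order.TTheory.

(** * Simplicial homotopies and weak equivalences *)

Lemma smap_inj (X Y : sset) (f g : smap X Y) : (forall n x, f n x = g n x) -> f = g.
Proof.
case: f g => [f fP] [g gP] /= fg.
have {}fg : f = g.
  by apply: functional_extensionality_dep => n; apply/funext => x; exact: fg.
case: _ / fg gP => gP; congr SMap; exact: Prop_irrelevance.
Qed.

Lemma smap_cmpA (W X Y Z : sset) (h : smap Y Z) (g : smap X Y) (f : smap W X) :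
  smap_cmp h (smap_cmp g f) = smap_cmp (smap_cmp h g) f.
Proof. exact: smap_inj. Qed.

Lemma smap_cmpm1 (X Y : sset) (f : smap X Y) : smap_cmp f (smap_id X) = f.
Proof. exact: smap_inj. Qed.

Definition sprodl (X Y Z : sset) (f : smap X Y) : smap (sprod X Z) (sprod Y Z) :=
  @SMap (sprod X Z) (sprod Y Z) (fun n x => (f n x.1, x.2))
    (fun m n t x => congr1 (pair^~ _) (sfunP f t x.1)).

Lemma homotopic_post (X Y Z : sset) (w : smap Y Z) (f g : smap X Y) :
  homotopic f g -> homotopic (smap_cmp w f) (smap_cmp w g).
Proof.
elim=> {f g} [f g [H [H0 H1]]|f|f g _|f g h _ IH1 _ IH2].
- apply: rst_step; exists (smap_cmp w H).
  by split=> n x /=; rewrite ?H0 ?H1.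
- exact: rst_refl.
- exact: rst_sym.
- exact: rst_trans IH1 IH2.
Qed.

Lemma homotopic_pre (X Y Z : sset) (w : smap X Y) (f g : smap Y Z) :
  homotopic f g -> homotopic (smap_cmp f w) (smap_cmp g w).
Proof.
elim=> {f g} [f g [H [H0 H1]]|f|f g _|f g h _ IH1 _ IH2].
- apply: rst_step; exists (smap_cmp H (sprodl (simplex 1) w)).
  by split=> n x /=; rewrite ?H0 ?H1.
- exact: rst_refl.
- exact: rst_sym.
- exact: rst_trans IH1 IH2.
Qed.

(** On homotopy classes of maps into a fixed [K], precomposition with [g] is a two-sided inverse of
    precomposition with [f]. *)
Lemma homotopy_equivalence_weak (X Y : sset) (f : smap X Y) (g : smap Y X) :
  homotopic (smap_cmp g f) (smap_id X) -> homotopic (smap_cmp f g) (smap_id Y) ->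
  weak_equivalence f.
Proof.
move=> gf fg K _; split=> [u|v v' vv'].
  exists (smap_cmp u g).
  by have := homotopic_post u gf; rewrite smap_cmpA smap_cmpm1.
have vfg (w : smap Y K) : homotopic (smap_cmp (smap_cmp w f) g) w.
  by have := homotopic_post w fg; rewrite smap_cmpA smap_cmpm1.
apply: rst_trans (vfg v'); apply: rst_trans (homotopic_pre g vv').
exact/rst_sym/vfg.
Qed.

(** * Homotopies of homotopy colimits from natural transformations *)

(** Pointwise agreement on arrows is what [hocolim_homotopy] can offer: there the two actions differ
    in the proofs of inequalities between bits. *)
Lemma hocolim_congr_hom (I : category) (D : diagram I) n (o : ordcat n -> I)
    (a a' : forall x y, hom (ordcat n) x y -> hom I (o x) (o y)) p1 p1' pM pM'
    (x x' : D (o ord0) n) : (forall y z h, a y z h = a' y z h) -> x = x' ->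
  @HocolimAt I D n (@Functor _ _ o a p1 pM) x =
  @HocolimAt I D n (@Functor _ _ o a' p1' pM') x'.
Proof.
move=> aa; have {}aa : a = a' by do 3!apply: functional_extensionality_dep => ?.
by case: _ / aa p1' pM' => p1' pM'; exact: hocolim_congr.
Qed.

Section HocolimHomotopy.
Variables (I J : category) (u v : functor I J) (th : forall i, hom J (u i) (v i)).
Hypothesis thP : forall i i' (f : hom I i i'),
  th i' \c fmap u f = fmap v f \c th i.

(** [th] as a functor [I x {0 < 1} -> J]. *)
Definition cyl_ob (b : bool) (i : I) : J := if b then v i else u i.

Definition cyl_hom (b b' : bool) : (b <= b')%N -> forall i i', hom I i i' ->
  hom J (cyl_ob b i) (cyl_ob b' i') :=
  match b, b' return (b <= b')%N -> forall i i', hom I i i' ->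
    hom J (cyl_ob b i) (cyl_ob b' i') with
  | false, false => fun _ i i' f => fmap u f
  | false, true => fun _ i i' f => fmap v f \c th i
  | true, true => fun _ i i' f => fmap v f
  | true, false => fun e => False_rect _ (notF e)
  end.

Lemma cyl_hom1 b bb i : @cyl_hom b b bb i i (idm i) = idm (cyl_ob b i).
Proof. by case: b bb => bb /=; rewrite fmap1. Qed.

Lemma cyl_homM (b b' b'' : bool) (bb' : (b <= b')%N) (bb'' : (b' <= b'')%N)
    (e : (b <= b'')%N) i i' i'' (g : hom I i' i'') (f : hom I i i') :
  cyl_hom e (g \c f) = cyl_hom bb'' g \c cyl_hom bb' f.
Proof.
case: b b' b'' bb' bb'' e => [] [] [] //= _ _ _; rewrite fmapM ?cmpA //.
(* The case left is [b = b' = false], [b'' = true]: the jump from [u] to [v] occurs after [f] on one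
   side and before it on the other. *)
by rewrite -!cmpA thP.
Qed.

Definition cyl_bit n (t : mono n 1) (i : 'I_n.+1) : bool := 0 < t i.

Lemma cyl_bitP n (t : mono n 1) (i j : 'I_n.+1) :
  i <= j -> (cyl_bit t i <= cyl_bit t j)%N.
Proof.
move=> ij; have := monofP t ij; rewrite /cyl_bit.
by case: (t i : nat) => // m; case: (t j : nat).
Qed.

(** A chain in [I] and a simplex of the interval form a chain in [I x {0 < 1}]; this is its image in
    [J]. *)
Definition cyl_chain n (c : nerve I n) (t : mono n 1) : nerve J n.
Proof.
exists (fun i : ordcat n => cyl_ob (cyl_bit t i) (c i))
  (fun i i' (ii' : hom (ordcat n) i i') => cyl_hom (cyl_bitP t ii') (fmap c ii')).
- by move=> i; rewrite fmap1 cyl_hom1.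
- by move=> x y z g f; rewrite fmapM; exact: cyl_homM.
Defined.

Variables (D : diagram I) (E : diagram J).

Section Point.
Variable a : forall i, smap (D i) (E (u i)).
Hypothesis aP : forall i i' (f : hom I i i') n (x : D i n),
  a i' n (dmap D f n x) = dmap E (fmap u f) n (a i n x).

(** The point of a simplex lies over the first object of its chain. If the first bit is already 1,
    that object is [v i], so the point is transported along [th]. *)
Definition cyl_point (b : bool) (i : I) : smap (D i) (E (cyl_ob b i)) :=
  if b return smap (D i) (E (cyl_ob b i)) then smap_cmp (dmap E (th i)) (a i) else a i.

Lemma cyl_pointP (b b' : bool) (bb' : (b <= b')%N) i i' (f : hom I i i') n (x : D i n) :
  cyl_point b' i' n (dmap D f n x) = dmap E (cyl_hom bb' f) n (cyl_point b i n x).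
Proof.
case: b b' bb' => [] [] //= bb'; rewrite aP //.
- by rewrite -!dmapM thP.
- by rewrite -!dmapM thP.
Qed.

Definition hocolim_homotopy : smap (sprod (hocolim D) (simplex 1)) (hocolim E).
Proof.
exists (fun n (s : sprod (hocolim D) (simplex 1) n) =>
  @HocolimAt J E n (cyl_chain (hchain s.1) s.2) (cyl_point _ _ n (hpoint s.1))).
move=> m n f [s t]; apply: hocolim_congr_hom => [y z h|] /=.
  exact: (congr1 (fun e => cyl_hom e _) (bool_irrelevance _ _)).
by rewrite -sfunP; exact: cyl_pointP.
Defined.

Lemma homotopic_hocolim_map (b : forall i, smap (D i) (E (v i)))
    (bP : forall i i' (f : hom I i i') n (x : D i n),
       b i' n (dmap D f n x) = dmap E (fmap v f) n (b i n x)) :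
  (forall i n x, b i n x = dmap E (th i) n (a i n x)) ->
  homotopic (hocolim_map aP) (hocolim_map bP).
Proof.
move=> ba; apply: rst_step; exists hocolim_homotopy.
(* On a constant bit the cylinder chain is the chain composed with [u] or with [v]; at bit 1 the
   point is that of [b] by [ba]. *)
by split=> n s; apply: hocolim_congr; rewrite //= ba.
Qed.

End Point.
End HocolimHomotopy.

Definition id_functor (C : category) : functor C C :=
  @Functor C C id (fun x y f => f) (fun x => erefl) (fun x y z g f => erefl).

(** * A criterion for a map of homotopy colimits to be an equivalence *)

Section HocolimEquivalence.
Variables (I J : category) (u : functor I J) (r : functor J I).
Variables (D : diagram I) (E : diagram J).
Variable t : forall i, smap (D i) (E (u i)).
Hypothesis tP : forall i i' (f : hom I i i') n (x : D i n),
  t i' n (dmap D f n x) = dmap E (fmap u f) n (t i n x).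
Variable s : forall j, smap (E j) (D (r j)).
Hypothesis sP : forall j j' (f : hom J j j') n (x : E j n),
  s j' n (dmap E f n x) = dmap D (fmap r f) n (s j n x).
Variable eta_ : forall j, hom J j (u (r j)).
Hypothesis etaP : forall j j' (f : hom J j j'),
  eta_ j' \c f = fmap u (fmap r f) \c eta_ j.
Hypothesis ts : forall j n (x : E j n), t (r j) n (s j n x) = dmap E (eta_ j) n x.
Variable zeta : forall i, hom I i (r (u i)).
Hypothesis zetaP : forall i i' (f : hom I i i'),
  zeta i' \c f = fmap r (fmap u f) \c zeta i.
Hypothesis st : forall i n (x : D i n), s (u i) n (t i n x) = dmap D (zeta i) n x.

(** The homotopy inverse is [hocolim_map sP]: [zeta] and [eta_] go from the identities to the two
    composites of [u] and [r], and [st], [ts] say that the diagram maps follow them. *)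
Lemma hocolim_map_weak_equivalence : weak_equivalence (hocolim_map tP).
Proof.
have idP (K : category) (X : diagram K) i i' (f : hom K i i') n (x : X i n) :
    smap_id (X i') n (dmap X f n x) = dmap X (fmap (id_functor K) f) n (smap_id (X i) n x).
  by [].
(* The identity has to be presented as induced by the identity functor, so that it can be an end of
   a homotopy built from [zeta] or [eta_]. *)
have hid (K : category) (X : diagram K) :
    smap_id (hocolim X) = @hocolim_map K K (id_functor K) X X _ (@idP K X).
  by apply: smap_inj => n [c x]; exact: hocolim_congr.
apply: (@homotopy_equivalence_weak _ _ _ (hocolim_map sP)); apply: rst_sym.
- have P i i' (f : hom I i i') n (x : D i n) :
      smap_cmp (s (u i')) (t i') n (dmap D f n x) =
      dmap D (fmap (fcomp r u) f) n (smap_cmp (s (u i)) (t i) n x).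
    by rewrite /= tP sP.
  have -> : smap_cmp (hocolim_map sP) (hocolim_map tP) =
      @hocolim_map _ _ (fcomp r u) D D _ P.
    by apply: smap_inj => n c; exact: hocolim_congr.
  by rewrite hid; apply: (@homotopic_hocolim_map _ _ (id_functor I) (fcomp r u) zeta).
- have P j j' (f : hom J j j') n (x : E j n) :
      smap_cmp (t (r j')) (s j') n (dmap E f n x) =
      dmap E (fmap (fcomp u r) f) n (smap_cmp (t (r j)) (s j) n x).
    by rewrite /= sP tP.
  have -> : smap_cmp (hocolim_map tP) (hocolim_map sP) =
      @hocolim_map _ _ (fcomp u r) E E _ P.
    by apply: smap_inj => n c; exact: hocolim_congr.
  by rewrite hid; apply: (@homotopic_hocolim_map _ _ (id_functor J) (fcomp u r) eta_).
Qed.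

End HocolimEquivalence.

(** * Convex hulls of images in closed trees *)

(** The existence statement [tree_hom_closedP] enters only in the proof field, so the edge map is
    [f] by computation. *)
Definition closed_hom (S T : tree) (cS : closed_tree S) (cT : closed_tree T)
    (f : S -> T) (fm : forall x y : S, (x <= y)%O -> (f x <= f y)%O)
    (fi : forall x y : S, ~~ (x >=< y)%O -> ~~ (f x >=< f y)%O) : tree_hom S T.
Proof.
exists f => l e le.
by have [g <-] := (tree_hom_closedP f cS cT).2 (conj fm fi); exact: hom_op.
Defined.

Lemma closed_hom_le (S T : tree) (f : tree_hom S T) :
  closed_tree S -> closed_tree T -> forall x y : S, (x <= y)%O -> (f x <= f y)%O.
Proof.
by move=> cS cT; case: ((tree_hom_closedP f cS cT).1 (ex_intro _ f erefl)).
Qed.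

Lemma closed_hom_incomparable (S T : tree) (f : tree_hom S T) :
  closed_tree S -> closed_tree T ->
  forall x y : S, ~~ (x >=< y)%O -> ~~ (f x >=< f y)%O.
Proof.
by move=> cS cT; case: ((tree_hom_closedP f cS cT).1 (ex_intro _ f erefl)).
Qed.

Section Hull.
Variables (S T : tree) (f : tree_hom S T).
Hypotheses (cS : closed_tree S) (cT : closed_tree T).

Definition in_hull (y : T) : bool :=
  [exists a : S, (f a <= y)%O] && [exists b : S, (y <= f b)%O].

Definition hull_edge := {y : T | in_hull y}.

HB.instance Definition _ := SubFinite.on hull_edge.
HB.instance Definition _ := [SubChoice_isSubPOrder of hull_edge by <: with tdisp T].

Lemma le_hull (x y : hull_edge) : (x <= y)%O = (val x <= val y)%O.
Proof. by []. Qed.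

Lemma lt_hull (x y : hull_edge) : (x < y)%O = (val x < val y)%O.
Proof. by rewrite !lt_def. Qed.

Lemma in_hull_image (a : S) : in_hull (f a).
Proof. by apply/andP; split; apply/existsP; exists a. Qed.

Lemma in_hull_convex (x y z : T) :
  in_hull x -> in_hull z -> (x <= y)%O -> (y <= z)%O -> in_hull y.
Proof.
move=> /andP[/existsP[a ax] _] /andP[_ /existsP[b zb]] xy yz.
apply/andP; split; apply/existsP.
- by exists a; exact: le_trans xy.
- by exists b; exact: le_trans zb.
Qed.

Definition hull : tree.
Proof.
exists (tdisp T) hull_edge set0.
(* The image of the root of [S] is least: every edge of the hull lies above some [f a], hence above
   [f r]. *)
- have [r rP] := tree_root S; exists (exist _ (f r) (in_hull_image r)) => x.
  have /andP[/existsP[a ax] _] := valP x.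
  by rewrite le_hull; apply: le_trans ax; exact: closed_hom_le.
- move=> x y z yx zx; rewrite /Order.comparable !le_hull.
  exact: tree_linear yx zx.
- by move=> x y; rewrite inE.
Defined.

(** By convexity, an edge of [T] strictly between [e] and an edge of the hull is in the hull. Hence
    covers of [e] in the hull are covers in [T]. *)
Lemma valence_hull (e : hull) : valence e <= valence (val (e : hull_edge)).
Proof.
rewrite /valence -(card_imset (above e) (@val_inj _ _ hull_edge)); apply/subset_leq_card/subsetP.
move=> _ /imsetP[x + ->]; rewrite !inE => /andP[ex /forallP xmin].
rewrite -lt_hull ex; apply/forallP => y; apply/implyP => ey; apply/implyP => yx.
have yh := in_hull_convex (valP e) (valP x) (ltW ey) yx.
have := xmin (exist _ y yh).
by rewrite lt_hull le_hull /= ey yx /= => /eqP <-.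
Qed.

Definition hull_incl : tree_hom hull T.
Proof. exact: (@closed_hom hull T erefl cT (fun x : hull_edge => val x)). Defined.

Definition hull_corestrict : tree_hom S hull.
Proof.
apply: (@closed_hom S hull cS erefl (fun a => exist _ (f a) (in_hull_image a))).
- by move=> x y xy; rewrite le_hull; exact: closed_hom_le.
- by move=> x y; exact: closed_hom_incomparable.
Defined.

Lemma hull_corestrict_rooted : rooted hull_corestrict.
Proof.
move=> r rP x; rewrite le_hull; have /andP[/existsP[a ax] _] := valP x.
by apply: le_trans ax; apply: (closed_hom_le f cS cT); exact: rP.
Qed.

Lemma hull_corestrict_max_surjective : max_surjective hull_corestrict.
Proof. by move=> y; have /andP[_ /existsP[b yb]] := valP y; exists b. Qed.

End Hull.

(** The map [g] carries the bounds [f a] and [f b] of an edge to [f' a] and [f' b]. *)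
Lemma in_hull_map (S T T' : tree) (f : tree_hom S T) (f' : tree_hom S T')
    (g : tree_hom T T') : closed_tree T -> closed_tree T' -> tree_cmp g f = f' ->
  forall x, in_hull f x -> in_hull f' (g x).
Proof.
move=> cT cT' <- x /andP[/existsP[a ax] /existsP[b xb]].
by apply/andP; split; apply/existsP; [exists a|exists b]; exact: (closed_hom_le g cT cT').
Qed.

Definition hull_map (S T T' : tree) (f : tree_hom S T) (f' : tree_hom S T')
    (cS : closed_tree S) (cT : closed_tree T) (cT' : closed_tree T')
    (g : tree_hom T T') (gf : tree_cmp g f = f') :
  tree_hom (hull f cS cT) (hull f' cS cT').
Proof.
apply: (@closed_hom (hull f cS cT) (hull f' cS cT') erefl erefl
  (fun x : hull_edge f => exist _ (g (val x)) (in_hull_map cT cT' gf (valP x)))).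
- by move=> x y; exact: (@closed_hom_le _ _ g cT cT' (val x) (val y)).
- by move=> x y; exact: (@closed_hom_incomparable _ _ g cT cT' (val x) (val y)).
Defined.

(** * The coreflection onto rooted max-surjective maps *)

Section Coreflection.
Variables (k j : option nat) (kj : leq_ext k j) (S : Omegac j).

Definition hull_Omegac (x : under (incl kj) S) : Omegac k :=
  @FullsubOb Omega (closed_dendroidal k)
    (hull (uarr x) (fsprop S).1 (fsprop (utgt x)).1)
    (conj erefl (fun e => @leq_ext_trans (Some _) (Some _) k
                   (valence_hull e) ((fsprop (utgt x)).2 _))).

Definition hull_rmax (x : under (incl kj) S) : under_rmax kj S :=
  @FullsubOb (under (incl kj) S)
    (fun x => rooted (uarr x) /\ max_surjective (uarr x))
    (@UnderOb _ _ (incl kj) S (hull_Omegac x) (@hull_corestrict _ _ (uarr x) _ _))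
    (conj (@hull_corestrict_rooted _ _ _ _ _)
          (@hull_corestrict_max_surjective _ _ _ _ _)).

Definition hull_rmax_hom (x y : under (incl kj) S) (g : hom _ x y) :
  hom _ (hull_rmax x) (hull_rmax y).
Proof.
exists (hull_map (fsprop S).1 (fsprop (utgt x)).1 (fsprop (utgt y)).1 (uvalP g)).
by apply: tree_hom_inj => a; apply: val_inj; rewrite /= -(uvalP g).
Defined.

Definition hull_functor : functor (under (incl kj) S) (under_rmax kj S).
Proof.
exists hull_rmax hull_rmax_hom.
- by move=> x; apply: under_hom_inj; apply: tree_hom_inj => a; exact: val_inj.
- by move=> x y z g f; apply: under_hom_inj; apply: tree_hom_inj => a; exact: val_inj.
Defined.

Definition hull_counit (x : under (incl kj) S) :
  hom (under (incl kj) S) (fsval (hull_rmax x)) x.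
Proof.
exists (@hull_incl _ _ (uarr x) (fsprop S).1 (fsprop (utgt x)).1 : hom (Omegac k) (hull_Omegac x) _).
exact: tree_hom_inj.
Defined.

(** On edges both composites are [g] restricted to the hull. *)
Lemma hull_counit_nat (x y : under (incl kj) S) (g : hom _ x y) :
  g \c hull_counit x = hull_counit y \c hull_rmax_hom g.
Proof. by apply: under_hom_inj; exact: tree_hom_inj. Qed.

End Coreflection.

(** * Comparison with the pointwise left Kan extension *)

Lemma rmax_map_weak_equivalence (k j : option nat) (kj : leq_ext k j)
    (F : presheaf (Omegac k)) (S : Omegac j) : weak_equivalence (rmax_map kj F S).
Proof.
unshelve refine (@hocolim_map_weak_equivalence _ _ (fop (fullsub_incl _))
  (fop (hull_functor kj S)) (rmax_diagram kj F S) (lan_diagram (incl kj) F S)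
  (fun x => smap_id (F (utgt (fsval x)))) (fun x y f n a => erefl)
  (fun x => pres F (uval (hull_counit x))) _
  (* Reversed in the opposite categories, the counit serves as [eta_]. Since the subcategory is
     full, its components at rooted max-surjective maps also serve as [zeta]. *)
  (fun x => hull_counit x) _ _ (fun x => hull_counit (fsval x)) _ _) => //.
- move=> x y f n a.
  (* Naturality of the inverse map is [F] applied to the naturality square of the counit. *)
  rewrite /= /pres -!(@dmapM (op (Omegac k)) F).
  exact: (congr1 (fun h => pres F (uval h) n a) (hull_counit_nat f)).
- by move=> x y f; exact: hull_counit_nat.
- by move=> x y f; exact: hull_counit_nat.
Qed.

Theorem corollary4p11 (k j : option nat) (k1 : leq_ext (Some 1) k)
  (kj : leq_ext k j) (F : unital_operad k1) (n : nat)
  (nj : leq_ext (Some n) j) :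
  weak_equivalence (rmax_map kj F (closed_corolla nj)).
Proof. exact: rmax_map_weak_equivalence. Qed.
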